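(* Let $\varepsilon>0$ and $\lambda_5>0$, and consider the system $$\begin{cases} C'= \lambda_7 R -(\varepsilon+\beta_1+\lambda_5) C + (\lambda_1+m\lambda_4) P_C+\lambda_2RP_C\\ R'= \lambda_5 C-(\varepsilon+\beta_2+\lambda_7)R + (\lambda_3+m\lambda_4) P_R +(\lambda_2+m_R\lambda_6)RP_R\\ P_C'=(1-\alpha)\gamma + \beta_1 C+ \lambda_7 P_R - (\varepsilon+\lambda_5+\lambda_1+m\lambda_4) P_C - \lambda_2RP_C \\ P_R'=\alpha \gamma + \beta_2 R + \lambda_5 P_C - (\varepsilon+\lambda_7+\lambda_3+m\lambda_4) P_R - (\lambda_2+m_R\lambda_6) RP_R. \end{cases}$$ Then: (a) the system has at most three equilibrium solutions $(R^*,C^*,P_R^*,P_C^* )$. The first component $R^*$ is always a nonnegative solution of the cubic equation $$aR^3+bR^2+cR+d=0,$$ where $$a=-\lambda_2(\lambda_2+m_R\lambda_6),$$ $$b=\lambda_2(\lambda_2+m_R\lambda_6)p-u(\lambda_2+m_R\lambda_6)-\lambda_2 v,$$ $$c=\lambda_2(\lambda_3+m\lambda_4)p+u(\lambda_2+m_R\lambda_6)p+(\lambda_7+\lambda_2 q)\lambda_5-uv,$$ $$d=(\lambda_3+m\lambda_4)pu+(\lambda_1+m\lambda_4)q\lambda_5;$$ (b) any equilibrium solution $(R^*,C^*,P_R^*,P_C^* )$ is obtained in the following way: $R^*$ is a nonnegative solution of the cubic equation $aR^3+bR^2+cR+d=0$ with these coefficients $a,b,c,d$, and $$P_R^*=p-R^*,\qquad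 P_C^*=q-C^*,\qquad C^*=\frac{(\varepsilon+\beta_2+\lambda_7)R^*-(\lambda_3+m\lambda_4+(\lambda_2+m_R\lambda_6)R^* )(p-R^* )}{\lambda_5}$$ are nonnegative constants.
   Context: The parameters $\lambda_1,\dots,\lambda_7,\beta_1,\beta_2,\varepsilon,\gamma,m,m_R$ are nonnegative real constants and $\alpha\in[0,1]$. An equilibrium solution is a constant solution with nonnegative components; here it is listed in the order $(R^*,C^*,P_R^*,P_C^* )$, where $R^*,C^*,P_R^*,P_C^*$ are the constant values of $R,C,P_R,P_C$. Notation: $$p=\frac{\gamma(\alpha\varepsilon+\lambda_5)}{\varepsilon(\varepsilon+\lambda_5+\lambda_7)},\qquad q=\frac{\gamma((1-\alpha)\varepsilon+\lambda_7)}{\varepsilon(\varepsilon+\lambda_5+\lambda_7)},$$ $$u=\varepsilon+\beta_1+\lambda_5+\lambda_1+m\lambda_4,\qquad v=\varepsilon+\beta_2+\lambda_7+\lambda_3+m\lambda_4.$$ *)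

(* Defs.v *)
From mathcomp Require Import all_boot all_order all_algebra.
From mathcomp Require Import all_classical all_reals all_analysis.

Set Implicit Arguments.
Unset Strict Implicit.
Unset Printing Implicit Defensive.

Import Order.TTheory GRing.Theory Num.Theory.
Import numFieldNormedType.Exports.

Local Open Scope classical_set_scope.
Local Open Scope ring_scope.

Record params (K : realType) := Params {
  lam1 : K; lam2 : K; lam3 : K; lam4 : K; lam5 : K; lam6 : K; lam7 : K;
  beta1 : K; beta2 : K;
  eps : K; gam : K; m : K; mR : K; alpha : K
}.

Definition admissible (K : realType) (P : params K) : Prop :=
  (0 <= lam1 P /\ 0 <= lam2 P /\ 0 <= lam3 P /\ 0 <= lam4 P /\
   0 <= lam5 P /\ 0 <= lam6 P /\ 0 <= lam7 P) /\
  (0 <= beta1 P /\ 0 <= beta2 P) /\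
  (0 <= eps P /\ 0 <= gam P /\ 0 <= m P /\ 0 <= mR P) /\
  (0 <= alpha P /\ alpha P <= 1).

Section System.
Variables (K : realType) (P : params K).

Let l1 := lam1 P. Let l2 := lam2 P. Let l3 := lam3 P. Let l4 := lam4 P.
Let l5 := lam5 P. Let l6 := lam6 P. Let l7 := lam7 P.
Let b1 := beta1 P. Let b2 := beta2 P.
Let e := eps P. Let g := gam P. Let m := m P. Let mR := mR P.
Let al := alpha P.

Definition fieldC (r c pr pc : K) : K :=
  l7 * r - (e + b1 + l5) * c + (l1 + m * l4) * pc + l2 * r * pc.

Definition fieldR (r c pr pc : K) : K :=
  l5 * c - (e + b2 + l7) * r + (l3 + m * l4) * pr + (l2 + mR * l6) * r * pr.

Definition fieldPC (r c pr pc : K) : K :=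
  (1 - al) * g + b1 * c + l7 * pr - (e + l5 + l1 + m * l4) * pc
  - l2 * r * pc.

Definition fieldPR (r c pr pc : K) : K :=
  al * g + b2 * r + l5 * pc - (e + l7 + l3 + m * l4) * pr
  - (l2 + mR * l6) * r * pr.

(* The system is autonomous; solutions are taken on the whole time line, which
   for constant functions is the same as on any nondegenerate interval. *)
Definition is_solution (R C PR PC : K -> K) : Prop :=
  forall t : K,
    is_derive t 1 C (fieldC (R t) (C t) (PR t) (PC t)) /\
    is_derive t 1 R (fieldR (R t) (C t) (PR t) (PC t)) /\
    is_derive t 1 PC (fieldPC (R t) (C t) (PR t) (PC t)) /\
    is_derive t 1 PR (fieldPR (R t) (C t) (PR t) (PC t)).

(* Equilibria are listed in the order (R, C, P_R, P_C). *)
Definition equilibrium (x : K * K * K * K) : Prop :=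
  let '(r, c, pr, pc) := x in
  is_solution (cst r) (cst c) (cst pr) (cst pc) /\
  0 <= r /\ 0 <= c /\ 0 <= pr /\ 0 <= pc.

Definition p : K := g * (al * e + l5) / (e * (e + l5 + l7)).
Definition q : K := g * ((1 - al) * e + l7) / (e * (e + l5 + l7)).
Definition u : K := e + b1 + l5 + l1 + m * l4.
Definition v : K := e + b2 + l7 + l3 + m * l4.

Definition coef_a : K := - l2 * (l2 + mR * l6).
Definition coef_b : K :=
  l2 * (l2 + mR * l6) * p - u * (l2 + mR * l6) - l2 * v.
Definition coef_c : K :=
  l2 * (l3 + m * l4) * p + u * (l2 + mR * l6) * p + (l7 + l2 * q) * l5 - u * v.
Definition coef_d : K := (l3 + m * l4) * p * u + (l1 + m * l4) * q * l5.

Definition cubic_solution (r : K) : Prop :=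
  coef_a * r ^+ 3 + coef_b * r ^+ 2 + coef_c * r + coef_d = 0.

End System.

(* Main.v *)
Require Import Defs.
From mathcomp Require Import all_boot all_order all_algebra.
From mathcomp Require Import all_classical all_reals all_analysis.
From mathcomp Require Import finmap ring lra.

Set Implicit Arguments.
Unset Strict Implicit.
Unset Printing Implicit Defensive.

Import Order.TTheory GRing.Theory Num.Theory.
Import numFieldNormedType.Exports.

Local Open Scope classical_set_scope.
Local Open Scope ring_scope.

(** At an equilibrium the four vector-field components vanish.  Adding those of
    [R] and [P_R], and those of [C] and [P_C], cancels every nonlinear term and
    every term in [beta1], [beta2], [lam1], [lam3], [lam4]: what remains is a
    linear system in the totals [R + P_R] and [C + P_C], with determinant
    [eps * (eps + lam5 + lam7) > 0].  Its only solution is [(p, q)]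
    ([totals_stationary]), so [P_R = p - R] and [P_C = q - C].

    Once these are substituted, the [R]-equation is affine in [C] with
    coefficient [lam5 > 0], which yields the formula for [C], and the
    combination [lam5 * fieldC + (u + lam2 * R) * fieldR] eliminates [C]: it is
    exactly the cubic in [R] ([cubic_elimination]).  Since [lam5] is nonzero,
    given the [R]-equation the [C]-equation is equivalent to the cubic.  This
    proves (b) and the second half of (a) ([equilibriumP]).

    An equilibrium is thus a function of its component [R], a root of the
    cubic, and the bound by three follows once the cubic is known not to vanish
    identically.  If [a = b = 0] then [lam2 = 0] and [lam2 + mR * lam6 = 0],
    whence [c = lam5 * lam7 - u * v], which is negative because [u] exceeds
    [lam5] and [v] exceeds [lam7] by at least [eps] ([cubic_nontrivial]). *)

(** Turns the list-based root bound for polynomials into a cardinality bound;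
    an infinite set is excluded because it has finite subsets of every size. *)
Lemma card_le_uniq_seq (T : choiceType) (A : set T) (n : nat) :
  (forall s : seq T, uniq s -> (forall x, x \in s -> A x) -> (size s <= n)%N) ->
  (A #<= `I_n)%card.
Proof.
move=> bnd; have [/finite_fsetP[X AX]|infA] := pselect (finite_set A).
  have /card_eq_fsetP cX : #|` X| = #|` X| by [].
  rewrite AX (card_le_eql cX) card_le_II; apply: bnd (fset_uniq X) _ => x.
  by rewrite AX.
have [B BA] := infinite_set_fset n.+1 infA.
by rewrite ltnNge (bnd _ (fset_uniq B) BA).
Qed.

Lemma card_le_roots (F : idomainType) (f : {poly F}) :
  f != 0 -> ([set x | root f x] #<= `I_(size f).-1)%card.
Proof.
move=> f0; apply: card_le_uniq_seq => s us rs.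
have : (size s < size f)%N by apply: max_poly_roots => //; apply/allP.
by case: (size f).
Qed.

Section Equilibria.
Variables (K : realType) (P : params K).

Lemma is_solution_cst (r c pr pc : K) :
  is_solution P (cst r) (cst c) (cst pr) (cst pc) <->
  [/\ fieldC P r c pr pc = 0, fieldR P r c pr pc = 0,
      fieldPC P r c pr pc = 0 & fieldPR P r c pr pc = 0].
Proof.
have cst_derive (a d : K) (t : K) : is_derive t 1 (cst a : K -> K) d <-> d = 0.
  split=> [D|->]; last exact: is_derive_cst.
  by rewrite -(derive_val (is_derive := D)) derive_cst.
split=> [/(_ 0)[/cst_derive ? [/cst_derive ? [/cst_derive ? /cst_derive ?]]] //|].
by case=> fC fR fPC fPR t; split; [|split; [|split]]; apply/cst_derive.
Qed.

(** The exchange terms of [R] with [P_R], and of [C] with [P_C], cancel in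
    these sums, so they only see the totals [R + P_R] and [C + P_C]. *)
Lemma total_fieldR (r c pr pc : K) :
  fieldR P r c pr pc + fieldPR P r c pr pc =
  alpha P * gam P + lam5 P * (c + pc) - (eps P + lam7 P) * (r + pr).
Proof. by rewrite /fieldR /fieldPR; ring. Qed.

Lemma total_fieldC (r c pr pc : K) :
  fieldC P r c pr pc + fieldPC P r c pr pc =
  (1 - alpha P) * gam P + lam7 P * (r + pr) - (eps P + lam5 P) * (c + pc).
Proof. by rewrite /fieldC /fieldPC; ring. Qed.

(** The multiplier [u + lam2 * R] is, up to sign, the coefficient of [C] in
    [fieldC] after the substitution of [P_C], and [lam5] is its coefficient in
    [fieldR]: the combination is the resultant of the two equations with respect
    to [C]. *)
Lemma cubic_elimination (r c : K) :
  lam5 P * fieldC P r c (p P - r) (q P - c) +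
    (u P + lam2 P * r) * fieldR P r c (p P - r) (q P - c) =
  coef_a P * r ^+ 3 + coef_b P * r ^+ 2 + coef_c P * r + coef_d P.
Proof.
rewrite /fieldC /fieldR /coef_a /coef_b /coef_c /coef_d /u /v.
by move: (p P) (q P) => p q; ring.
Qed.

Definition C_numerator (r : K) : K :=
  (eps P + beta2 P + lam7 P) * r
  - (lam3 P + m P * lam4 P + (lam2 P + mR P * lam6 P) * r) * (p P - r).

Lemma fieldR_numerator (r c pc : K) :
  fieldR P r c (p P - r) pc = lam5 P * c - C_numerator r.
Proof. by rewrite /fieldR /C_numerator; ring. Qed.

Hypotheses (hP : admissible P) (heps : 0 < eps P) (hlam5 : 0 < lam5 P).

(** The linear system for the totals has determinant
    [eps * (eps + lam5 + lam7)], and [p], [q] are Cramer's formulas. *)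
Lemma totals_stationary (X Y : K) :
  alpha P * gam P + lam5 P * Y - (eps P + lam7 P) * X = 0 /\
  (1 - alpha P) * gam P + lam7 P * X - (eps P + lam5 P) * Y = 0 <->
  X = p P /\ Y = q P.
Proof.
have lam7_ge0 : 0 <= lam7 P by case: hP; intuition.
have e0 : eps P != 0 by rewrite gt_eqF.
have s0 : eps P + lam5 P + lam7 P != 0 by rewrite gt_eqF// ltr_wpDr// addr_gt0.
have D0 : eps P * (eps P + lam5 P + lam7 P) != 0 by rewrite mulf_neq0.
split=> [[]|[-> ->]].
  set eqX := (X in X = 0); set eqY := (X in _ -> X = 0 -> _) => eqX0 eqY0.
  (* Cramer's rule: weight the equations by the entries of the adjugate. *)
  split; apply/(mulIf D0); rewrite /p /q divfK//; apply/esym/subr0_eq.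
    transitivity ((eps P + lam5 P) * eqX + lam5 P * eqY).
      by rewrite /eqX /eqY; ring.
    by rewrite eqX0 eqY0 !mulr0 addr0.
  transitivity (lam7 P * eqX + (eps P + lam7 P) * eqY).
    by rewrite /eqX /eqY; ring.
  by rewrite eqX0 eqY0 !mulr0 addr0.
by rewrite /p /q; split; field; apply/andP.
Qed.

(** The four equations are traded for an equivalent set: the two sums, which fix
    the totals, the [R]-equation, which gives [C] since [lam5] is nonzero, and
    the [C]-equation, which [cubic_elimination] turns into the cubic. *)
Lemma equilibriumP (r c pr pc : K) :
  equilibrium P (r, c, pr, pc) <->
  [/\ cubic_solution P r, pr = p P - r, pc = q P - c &
      c = C_numerator r / lam5 P] /\
  [/\ 0 <= r, 0 <= c, 0 <= pr & 0 <= pc].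
Proof.
have l50 : lam5 P != 0 by rewrite gt_eqF.
rewrite /equilibrium is_solution_cst; split.
  case=> -[fC fR fPC fPR] [r0 [c0 [pr0 pc0]]]; split=> //.
  have [|tX tY] := (totals_stationary (r + pr) (c + pc)).1.
    rewrite -(total_fieldR r c pr pc) -(total_fieldC r c pr pc).
    by rewrite fC fR fPC fPR addr0.
  have epr : pr = p P - r by rewrite -tX addrC addKr.
  have epc : pc = q P - c by rewrite -tY addrC addKr.
  move: fC fR; rewrite epr epc => fC fR; split=> //.
    by rewrite /cubic_solution -(cubic_elimination r c) fC fR !mulr0 addr0.
  move: fR; rewrite fieldR_numerator => /eqP; rewrite subr_eq0 => /eqP <-.
  by rewrite mulrC mulKf.
case=> -[cub epr epc ec] [r0 c0 pr0 pc0]; split=> //.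
have fR : fieldR P r c pr pc = 0.
  by rewrite epr fieldR_numerator ec mulrC divfK// subrr.
have fC : fieldC P r c pr pc = 0.
  apply: (mulfI l50); rewrite mulr0 -[RHS]cub -(cubic_elimination r c).
  by rewrite -epr -epc fR mulr0 addr0.
have [|tR tC] := (totals_stationary (r + pr) (c + pc)).2.
  by split; [rewrite epr|rewrite epc]; ring.
move: tR tC; rewrite -(total_fieldR r c pr pc) -(total_fieldC r c pr pc).
by rewrite fC fR !add0r => -> ->.
Qed.

Definition equilibrium_cubic : {poly K} :=
  Poly [:: coef_d P; coef_c P; coef_b P; coef_a P].

Lemma root_equilibrium_cubic (r : K) :
  root equilibrium_cubic r <-> cubic_solution P r.
Proof.
rewrite /root /cubic_solution horner_Poly /= (_ : _ + coef_d P =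
  coef_a P * r ^+ 3 + coef_b P * r ^+ 2 + coef_c P * r + coef_d P).
  by split=> /eqP.
by ring.
Qed.

(** When the coefficients of degree 3 and 2 vanish, that of degree 1 is
    negative, since [u * v > lam5 * lam7]. *)
Lemma cubic_nontrivial : equilibrium_cubic != 0.
Proof.
apply/eqP => /polyP f0.
have := f0 3%N; have := f0 2%N; have := f0 1%N.
rewrite !coef0 !coef_Poly /= => c0 b0 a0.
case: (hP) => -[l1 [l2 [l3 [l4 [l5 [l6 l7]]]]]] [[b1 b2] [[_ [_ [m0 mR0]]] _]].
have ml4 : 0 <= m P * lam4 P by apply: mulr_ge0.
have mRl6 : 0 <= mR P * lam6 P by apply: mulr_ge0.
have lt_pad (x1 x2 x3 x4 x5 : K) : 0 < x1 -> 0 <= x2 -> 0 <= x4 -> 0 <= x5 ->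
    x3 < x1 + x2 + x3 + x4 + x5 by move=> *; lra.
have u5 : lam5 P < u P by apply: lt_pad.
have v7 : lam7 P < v P by apply: lt_pad.
have u0 : u P != 0 by rewrite gt_eqF// (lt_trans hlam5).
have lam2_0 : lam2 P = 0.
  move: a0; rewrite /coef_a => /eqP; rewrite mulf_eq0 oppr_eq0 => /orP[/eqP//|].
  by rewrite paddr_eq0// => /andP[/eqP].
have M0 : lam2 P + mR P * lam6 P = 0.
  move: b0; rewrite /coef_b lam2_0 !mul0r subr0 sub0r => /eqP.
  by rewrite oppr_eq0 mulf_eq0 (negbTE u0) /= => /eqP.
move: c0; rewrite /coef_c M0 lam2_0 mulr0 !mul0r !addr0 add0r => /eqP.
rewrite subr_eq0 mulrC => /eqP uv.
by have := ltr_pM (ltW hlam5) l7 u5 v7; rewrite uv ltxx.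
Qed.

(** [R] determines the other three components, so the equilibria are covered by
    the image of the roots of the cubic. *)
Lemma card_equilibria : ([set x | equilibrium P x] #<= `I_3)%card.
Proof.
pose g (r : K) : K * K * K * K :=
  let c := C_numerator r / lam5 P in (r, c, p P - r, q P - c).
have sub : [set x | equilibrium P x] `<=` g @` [set r | root equilibrium_cubic r].
  move=> [[[r c] pr] pc] /equilibriumP[[cub -> -> ->] _].
  by exists r => //; apply/root_equilibrium_cubic.
apply: card_le_trans (subset_card_le sub) _.
apply: card_le_trans (card_image_le _ _) _.
apply: card_le_trans (card_le_roots cubic_nontrivial) _.
rewrite card_le_II -ltnS prednK ?size_poly_gt0 ?cubic_nontrivial//.
exact: size_Poly.
Qed.

End Equilibria.

Theorem theorem1 (K : realType) (P : params K) (hP : admissible P)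
    (heps : 0 < eps P) (hlam5 : 0 < lam5 P) :
  (* (a) *)
  ((([set x | equilibrium P x] : set (K * K * K * K)) #<= `I_3)%card /\
   (forall r c pr pc : K, equilibrium P (r, c, pr, pc) ->
      0 <= r /\ cubic_solution P r)) /\
  (* (b) *)
  (forall r c pr pc : K,
     equilibrium P (r, c, pr, pc) <->
     (0 <= r /\ cubic_solution P r) /\
     (pr = p P - r /\
      pc = q P - c /\
      c = ((eps P + beta2 P + lam7 P) * r
           - (lam3 P + m P * lam4 P + (lam2 P + mR P * lam6 P) * r) * (p P - r))
          / lam5 P) /\
     (0 <= pr /\ 0 <= pc /\ 0 <= c)).
Proof.
split; first split; first exact: card_equilibria.
  by move=> r c pr pc /(equilibriumP hP heps hlam5)[[cub _ _ _] [r0 _ _ _]].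
move=> r c pr pc; rewrite (equilibriumP hP heps hlam5).
split=> [[[cub epr epc ec] [r0 c0 pr0 pc0]] //|].
by case=> -[r0 cub] [[epr [epc ec]] [pr0 [pc0 c0]]].
Qed.
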